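(* Let $\mathcal{X}$ be a real Banach space with $\dim\mathcal{X}\ge 2$. For some fixed $p>1$ let $\mathcal{F}=\frac1p\|\cdot\|^p$ on $\mathcal{X}$, and let $j_p$ be a selection of the duality mapping $J_p$ of $\mathcal{X}$. 1. For all $\bar\tau>0$ there exists a constant $C_{\bar\tau,p}>0$ such that for $x\in S_{\mathcal{X}}$ and $\tau\le\bar\tau$ we have $$\rho_{\mathcal{F},x}^{j_p(x)}(\tau)\le C_{\bar\tau,p}\,\rho_{\mathcal{X}}(\tau).$$ 2. If for $\bar\tau>0$, $\tau\le\bar\tau$ and all $x\in S_{\mathcal{X}}$ we have $$\rho_{\mathcal{F},x}^{j_p(x)}(\tau)\le\phi(\tau),$$ then, with a constant $C_{\bar\tau}$, $$\rho_{\mathcal{X}}(\tau)\le p^{1/p-1}\phi(\tau)+C_{\bar\tau}\tau^2\qquad\text{for }\tau\le\bar\tau.$$ In particular, if $\phi:\mathbb{R}^+\to\mathbb{R}^+$ fulfills $\lim_{\tau\to0}\phi(\tau)/\tau=0$, then $\mathcal{X}$ is uniformly smooth. 3. Let $\frac1p+\frac1{p'}=1$. For all $x\in S_{\mathcal{X}}$ and $\bar\tau>0$ we have $$\delta_{\mathcal{F},x}^{j_p(x)}(\tau)\ge C_{\bar\tau,p'}\,\delta_{\mathcal{X}}\!\left(\tau/C_{\bar\tau,p'}\right),\qquad \tau\le C_{\bar\tau,p'}\,\rho_{\mathcal{X}^*}(\bar\tau)/\bar\tau,$$ where $C_{\bar\tau,p'}$ is the constant from part 1 (with $p'$ in place of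 $p$) and $\rho_{\mathcal{X}^*}(\bar\tau)/\bar\tau>0$. 4. If there exists $\bar\tau>0$ such that for all $x\in S_{\mathcal{X}}$ and $\tau\le\bar\tau$ we have $$\delta_{\mathcal{F},x}^{j_p(x)}(\tau)\ge\phi(\tau),$$ where $\phi:\mathbb{R}^+\to\mathbb{R}^+$ is nondecreasing and $\phi(\tau)>0$ for $\tau>0$, then $\mathcal{X}$ is uniformly convex.
   Context: $S_{\mathcal{X}}=\{x\in\mathcal{X}:\|x\|=1\}$; $\mathcal{X}^*$ is the dual space. Duality mapping: $J_p(x)=\{x^*\in\mathcal{X}^*:\langle x^*,x\rangle=\|x^*\|\|x\|,\ \|x^*\|=\|x\|^{p-1}\}$; a selection of $J_p$ is a map $j_p:\mathcal{X}\to\mathcal{X}^*$ with $j_p(x)\in J_p(x)$ for all $x\in\mathcal{X}$. Moduli of the space: the modulus of convexity is $\delta_{\mathcal{X}}:[0,2]\to[0,1]$, $\delta_{\mathcal{X}}(\varepsilon)=\inf\{1-\|y+\tilde y\|/2: y,\tilde y\in S_{\mathcal{X}},\|y-\tilde y\|=\varepsilon\}$, and the modulus of smoothness is $\rho_{\mathcal{X}}:[0,\infty)\to[0,\infty)$, $\rho_{\mathcal{X}}(\tau)=\sup\{(\|x+\tau y\|+\|x-\tau y\|)/2-1:x,y\in S_{\mathcal{X}}\}$; $\rho_{\mathcal{X}^*}$ is the modulus of smoothness of $\mathcal{X}^*$. $\mathcal{X}$ is uniformly convex if $\delta_{\mathcal{X}}(\varepsilon)>0$ for every $\varepsilon>0$,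 and uniformly smooth if $\lim_{\tau\to0}\rho_{\mathcal{X}}(\tau)/\tau=0$. Moduli of a functional: for $\mathcal{F}:\mathcal{X}\to\mathbb{R}\cup\{\infty\}$, $x\in\mathcal{X}$ with $\mathcal{F}(x)<\infty$, and $\xi\in\mathcal{X}^*$, put $\Delta_{\mathcal{F}}^{\xi}(y,x)=\mathcal{F}(y)-\mathcal{F}(x)-\langle\xi,y-x\rangle$ and, for $\tau\ge0$, $$\rho_{\mathcal{F},x}^{\xi}(\tau)=\sup_{\|x-y\|=\tau}|\Delta_{\mathcal{F}}^{\xi}(y,x)|,\qquad \delta_{\mathcal{F},x}^{\xi}(\tau)=\inf_{\|x-y\|=\tau}|\Delta_{\mathcal{F}}^{\xi}(y,x)|.$$
   Formalization: In part 2 the coefficient p^{1/p-1}, read literally as p^{(1/p)-1}, is replaced by p^{1/(p-1)}; the literal bound fails for the plane with the l^1 norm and p=4, where rho_X(τ)=τ and φ(τ)=2τ+Kτ^2 is admissible. *)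

(* Defs.v *)
From HB Require Import structures.
From mathcomp Require Import all_boot all_order all_algebra.
From mathcomp Require Import all_classical all_reals all_analysis.

Set Implicit Arguments.
Unset Strict Implicit.
Unset Printing Implicit Defensive.

Import Order.TTheory GRing.Theory Num.Theory.
Import numFieldNormedType.Exports.

Local Open Scope classical_set_scope.
Local Open Scope ring_scope.

Section Dual.
Context {R : realType} (X : normedModType R).

Definition dual_pred : {pred X -> R^o} :=
  [pred f | `[< linear f /\ continuous f >]].

Record dual := Dual { dual_fun :> X -> R^o; _ : dual_fun \in dual_pred }.

HB.instance Definition _ := [isSub for dual_fun].
HB.instance Definition _ := [Choice of dual by <:].

Lemma dual_predP (f : X -> R^o) :
  reflect (linear f /\ continuous f) (f \in dual_pred).
Proof. exact: asboolP. Qed.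

Lemma dual_submod_closed : submod_closed dual_pred.
Proof.
split.
  apply/dual_predP; split; first by move=> a x y; rewrite [RHS]addr0 [RHS]scaler0.
  by move=> x; exact: cvg_cst.
move=> a f g /dual_predP[lf cf] /dual_predP[lg cg]; apply/dual_predP; split.
  move=> b x y; rewrite !fctE lf lg !scalerDr !scalerA (mulrC a b).
  by rewrite addrACA.
by move=> x; apply: cvgD; [apply: cvgZl_tmp; exact: cf|exact: cg].
Qed.

HB.instance Definition _ :=
  GRing.isSubmodClosed.Build R (X -> R^o) dual_pred dual_submod_closed.
HB.instance Definition _ := [SubChoice_isSubLmodule of dual by <:].

Lemma dual_linear (f : dual) : linear f.
Proof. by case: f => f /= /dual_predP[]. Qed.

Lemma dual_continuous (f : dual) : continuous f.
Proof. by case: f => f /= /dual_predP[]. Qed.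

HB.instance Definition _ (f : dual) :=
  GRing.isLinear.Build R X R^o *:%R (f : X -> R^o) (dual_linear f).

Definition dual_norm (f : dual) : R :=
  sup [set `|f x : R| | x in [set x : X | `|x| <= 1]].

Lemma dual_norm_has_sup (f : dual) :
  has_sup [set `|f x : R| | x in [set x : X | `|x| <= 1]].
Proof.
split; first by exists `|f 0 : R|; exists 0 => //=; rewrite normr0.
have /linear_boundedP/pinfty_ex_gt0[r r0 fr] : bounded_near f (nbhs (0 : X)).
  exact/linear_bounded_continuous/dual_continuous.
exists r => _ [x /= x1 <-]; apply: (le_trans (fr x)).
by rewrite ler_piMr// ltW.
Qed.

Lemma dual_norm_ub (f : dual) (x : X) : `|f x : R| <= dual_norm f * `|x|.
Proof.
have [->|x0] := eqVneq x 0; first by rewrite linear0 !normr0 mulr0.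
have nx0 : 0 < `|x| by rewrite normr_gt0.
rewrite -ler_pdivrMr// mulrC.
have -> : `|x|^-1 * `|f x : R| = `|f (`|x|^-1 *: x) : R|.
  by rewrite linearZ/= normrZ ger0_norm// invr_ge0.
apply: (sup_upper_bound (dual_norm_has_sup f)).
exists (`|x|^-1 *: x) => //=.
by rewrite normrZ ger0_norm ?invr_ge0// mulVf ?gt_eqF.
Qed.

Lemma dual_ler_normD (f g : dual) :
  dual_norm (f + g) <= dual_norm f + dual_norm g.
Proof.
apply: ge_sup; first exact: (dual_norm_has_sup (f + g)).1.
move=> _ [x /= x1 <-]; apply: (le_trans (ler_normD _ _)).
by apply: lerD; apply: (sup_upper_bound (dual_norm_has_sup _)); exists x.
Qed.

Lemma dual_norm_scale_le (a : R) (f : dual) :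
  dual_norm (a *: f) <= `|a| * dual_norm f.
Proof.
apply: ge_sup; first exact: (dual_norm_has_sup (a *: f)).1.
move=> _ [x /= x1 <-]; rewrite [X in `|X|](_ : _ = a * f x)// normrM.
apply: ler_wpM2l => //.
by apply: (sup_upper_bound (dual_norm_has_sup _)); exists x.
Qed.

Lemma dual_normrZ (a : R) (f : dual) : dual_norm (a *: f) = `|a| * dual_norm f.
Proof.
apply/eqP; rewrite eq_le dual_norm_scale_le/=.
have [->|a0] := eqVneq a 0.
  rewrite normr0 mul0r scale0r.
  apply: (sup_upper_bound (dual_norm_has_sup 0)).
  by exists 0 => /=; rewrite normr0.
rewrite -ler_pdivlMl ?normr_gt0// -normfV.
by rewrite -[in leLHS](scalerK a0 f) dual_norm_scale_le.
Qed.

Lemma dual_normr0_eq0 (f : dual) : dual_norm f = 0 -> f = 0.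
Proof.
move=> f0; apply: val_inj; apply/funext => x /=.
have := dual_norm_ub f x; rewrite f0 mul0r normr_le0 => /eqP.
exact.
Qed.

HB.instance Definition _ :=
  Lmodule_isNormed.Build R dual dual_ler_normD dual_normrZ dual_normr0_eq0.

End Dual.

Definition dim_ge2 (R : realType) (X : normedModType R) :=
  exists x y : X, forall a b : R, a *: x + b *: y = 0 -> a = 0 /\ b = 0.

Definition duality_map (R : realType) (X : normedModType R) (p : R) (x : X) :
    set (dual X) :=
  [set f : dual X | (f x : R) = `|f| * `|x| /\ `|f| = `|x| `^ (p - 1)].

Definition duality_selection (R : realType) (X : normedModType R) (p : R)
    (j : X -> dual X) :=
  forall x, duality_map p x (j x).

(* The real [inf] and [sup] below are the intended ones as soon as the space
   has dimension at least 2 (and 0 <= e <= 2, resp. 0 <= t): the sets are then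
   nonempty and bounded. *)
Definition convexity_modulus (R : realType) (X : normedModType R) (e : R) : R :=
  inf [set r | exists y z : X,
    [/\ `|y| = 1, `|z| = 1, `|y - z| = e & r = 1 - `|y + z| / 2]].

Definition smoothness_modulus (R : realType) (X : normedModType R) (t : R) : R :=
  sup [set r | exists x y : X,
    [/\ `|x| = 1, `|y| = 1 & r = (`|x + t *: y| + `|x - t *: y|) / 2 - 1]].

Definition uniformly_convex (R : realType) (X : normedModType R) :=
  forall e : R, 0 < e <= 2 -> 0 < convexity_modulus X e.

Definition uniformly_smooth (R : realType) (X : normedModType R) :=
  smoothness_modulus X t / t @[t --> (0 : R)^'+] --> (0 : R).

Section FunctionalModuli.
Context {R : realType} {X : normedModType R}.
Local Open Scope ereal_scope.

Definition bregman (F : X -> \bar R) (xi : dual X) (y x : X) : \bar R :=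
  F y - F x - (xi (y - x)%R)%:E.

Definition functional_smoothness_modulus
    (F : X -> \bar R) (xi : dual X) (x : X) (t : R) : \bar R :=
  ereal_sup [set `|bregman F xi y x| | y in [set y | `|x - y|%R = t]].

Definition functional_convexity_modulus
    (F : X -> \bar R) (xi : dual X) (x : X) (t : R) : \bar R :=
  ereal_inf [set `|bregman F xi y x| | y in [set y | `|x - y|%R = t]].

End FunctionalModuli.

Definition norm_power (R : realType) (X : normedModType R) (p : R) (x : X) :
    \bar R :=
  (p^-1 * `|x| `^ p)%:E.

(* Main.v *)
Require Import Defs.
From HB Require Import structures.
From mathcomp Require Import all_boot all_order all_algebra.
From mathcomp Require Import all_classical all_reals all_analysis.
From mathcomp Require Import ring lra.

Set Implicit Arguments.
Unset Strict Implicit.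
Unset Printing Implicit Defensive.

Import Order.TTheory GRing.Theory Num.Theory.
Import numFieldNormedType.Exports.

Local Open Scope classical_set_scope.
Local Open Scope ring_scope.

(* Write y = x + z with |x| = 1 and j_p(x) = f.

   Upper bounds.  Since |x - z| >= 1 - f(z), the modulus of smoothness gives
   |x + z| - 1 <= f(z) + 2 rho(|z|), so the Bregman distance is at most
   2 rho(|z|) plus a second-order term K |z|^2, and rho(t) >= t^2 / (8 + 4 t)
   absorbs the latter.  Conversely |y|^p >= 1 + p (|y| - 1), so averaging the
   Bregman distances to x + z and x - z bounds rho by phi without remainder.

   Lower bounds.  By Young's inequality the Bregman distance at |y - x| = t is
   at least s t - D*, where D* is the Bregman distance of the conjugate power
   from f to f + s h and h norms y - x; the upper bound in the dual space gives
   D* <= C rho*(s).  With e = t / C and s = 2 delta(e) / e one has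
   rho*(s) <= delta(e), which leaves C (s e - delta(e)) = C delta(e). *)

(** * Elementary inequalities for real powers *)

Section RealPowers.
Context {R : realType}.
Implicit Types a p q t : R.

(** Young's inequality for the product of [1] and [a ^ (p - 1)], with exponents [p] and
    [p / (p - 1)]. *)
Lemma powR_conjugate_tangent a p : 0 <= a -> 1 < p ->
  p * a `^ (p - 1) <= 1 + (p - 1) * a `^ p.
Proof.
move=> a0 p1.
have [p0 q0] : 0 < p /\ 0 < p - 1 by lra.
have pq : p^-1 + (p / (p - 1))^-1 = 1 by field; rewrite !gt_eqF.
have := conjugate_powR ler01 (powR_ge0 a (p - 1)) p0 (divr_gt0 p0 q0) pq.
rewrite powR1 !mul1r -powRrM.
have -> : (p - 1) * (p / (p - 1)) = p by field; rewrite gt_eqF.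
move=> /(ler_wpM2l (ltW p0)) /le_trans; apply.
by rewrite le_eqVlt; apply/orP; left; apply/eqP; field; rewrite !gt_eqF.
Qed.

(** Young's inequality for the product of [a] and [1]. *)
Lemma powR_bernoulli a p : 0 <= a -> 1 < p -> 1 + p * (a - 1) <= a `^ p.
Proof.
move=> a0 p1.
have [p0 q0] : 0 < p /\ 0 < p - 1 by lra.
have pq : p^-1 + (p / (p - 1))^-1 = 1 by field; rewrite !gt_eqF.
have := conjugate_powR a0 ler01 p0 (divr_gt0 p0 q0) pq.
rewrite powR1 mulr1 invf_div mul1r => /(ler_wpM2l (ltW p0)).
have -> : p * (a `^ p / p + (p - 1) / p) = a `^ p + p - 1.
  by field; rewrite gt_eqF.
lra.
Qed.

(** One summand for each range of the base in [powR_quadratic]: below 1/2, between 1/2 and 1, above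
    1. *)
Definition powR_quadratic_const t p : R :=
  2 + 2 * (p - 1) + (p - 1) * (1 + t) `^ (p - 1).

Lemma powR_quadratic_const_ge2 t p : 1 < p -> 2 <= powR_quadratic_const t p.
Proof.
move=> p1; have := powR_ge0 (1 + t) (p - 1).
by rewrite /powR_quadratic_const => ?; nra.
Qed.

(** By [powR_conjugate_tangent] the left side is at most [(a ^ (p - 1) - 1) (a - 1)], so it remains
    to bound the first factor linearly in [a - 1]. No second derivative appears; for [p < 2] it
    would be unbounded near 0. *)
Lemma powR_quadratic a t p : 0 <= a <= 1 + t -> 1 < p ->
  p^-1 * a `^ p - p^-1 - (a - 1) <= powR_quadratic_const t p * (a - 1) ^+ 2.
Proof.
move=> /andP[a0 at1] p1.
have [p0 q0] : 0 < p /\ 0 < p - 1 by lra.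
set q := p - 1; set K := powR_quadratic_const t p.
have {}q0 : 0 < q by [].
have aq : a `^ p = a * a `^ q.
  have e : 1 + (p - 1) = p by ring.
  by rewrite /q -{2}(powRr1 a0) -powRD e// gt_eqF.
have h1 : p^-1 * a `^ p - p^-1 - (a - 1) <= (a `^ q - 1) * (a - 1).
  have := powR_conjugate_tangent a0 p1; rewrite -/q aq => h.
  rewrite -(ler_pM2l p0).
  have -> : p * (p^-1 * (a * a `^ q) - p^-1 - (a - 1)) =
     a * a `^ q - 1 - p * (a - 1) by field; rewrite gt_eqF.
  by rewrite /q in h *; nra.
apply: (le_trans h1); rewrite expr2 mulrA.
have Pge0 := powR_ge0 (1 + t) q.
have [a1|a1] := leP 1 a.
  apply: ler_wpM2r; first by lra.
  have a_gt0 : 0 < a by lra.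
  have e1 : a `^ q - 1 <= q * (a - 1) * a `^ q.
    have ln1 : ln a <= a - 1.
      by have := @le_ln1Dx R (a - 1); rewrite (addrC 1) subrK; apply; lra.
    have := expR_ge1Dx (- (q * ln a)).
    rewrite expRN -[X in X^-1](_ : a `^ q = _); last by rewrite /powR gt_eqF.
    have aq0 : 0 < a `^ q by rewrite powR_gt0.
    rewrite -(ler_pM2r aq0) mulVf ?gt_eqF// => h.
    have : q * ln a * a `^ q <= q * (a - 1) * a `^ q.
      by rewrite ler_pM2r// ler_pM2l.
    lra.
  have e2 : a `^ q <= (1 + t) `^ q.
    by apply: ge0_ler_powR; rewrite ?nnegrE//; lra.
  apply: (le_trans e1).
  have : q * (a - 1) * a `^ q <= q * (a - 1) * (1 + t) `^ q.
    by rewrite ler_wpM2l// mulr_ge0//; lra.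
  move=> /le_trans; apply; rewrite /K /powR_quadratic_const -/q; nra.
rewrite -[X in X <= _]mulrNN -[X in _ <= X]mulrNN.
apply: ler_wpM2r; first by lra.
rewrite opprB -mulrN opprB.
have Kbig : 2 + 2 * q <= K by rewrite /K /powR_quadratic_const -/q; nra.
(* Below 1/2, [1 - a ^ q <= 1 <= 2 (1 - a)]. From 1/2 on, [ln a^-1 <= a^-1 - 1 <= 2 (1 - a)]. *)
have [a2|a2] := ltP a (1/2).
  have := powR_ge0 a q; nra.
have a_gt0 : 0 < a by lra.
have e1 : 1 - a `^ q <= 2 * q * (1 - a).
  have ln1 : ln a^-1 <= a^-1 - 1.
    have := @le_ln1Dx R (a^-1 - 1); rewrite (addrC 1) subrK; apply.
    have : 0 < a^-1 by rewrite invr_gt0.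
    lra.
  have := expR_ge1Dx (q * ln a).
  rewrite -[X in _ <= X](_ : a `^ q = _); last by rewrite /powR gt_eqF.
  have -> : ln a = - ln a^-1 by rewrite lnV ?opprK// posrE.
  have : a^-1 - 1 <= 2 * (1 - a).
    rewrite -(ler_pM2l a_gt0) mulrBr mulfV ?gt_eqF//; nra.
  nra.
nra.
Qed.

End RealPowers.

(** * The modulus of smoothness and its quadratic lower bound *)

Section SmoothnessModulus.
Context {R : realType} {E : normedModType R}.
Implicit Types (x y z : E) (s t : R).
Local Notation rho := (smoothness_modulus E).

Lemma smoothness_modulus_ub x y t : `|x| = 1 -> `|y| = 1 ->
  `|x + t *: y| + `|x - t *: y| <= 2 + 2 * rho t.
Proof.
move=> x1 y1.
suff : (`|x + t *: y| + `|x - t *: y|) / 2 - 1 <= rho t by lra.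
apply: ub_le_sup; last by exists x, y.
exists `|t| => _ [u [v [u1 v1 ->]]].
have := ler_normD u (t *: v); have := ler_normB u (t *: v).
rewrite normrZ u1 v1 mulr1; lra.
Qed.

Lemma smoothness_modulus_le x0 t c : `|x0| = 1 ->
  (forall x y, `|x| = 1 -> `|y| = 1 ->
    `|x + t *: y| + `|x - t *: y| <= 2 + 2 * c) ->
  rho t <= c.
Proof.
move=> x01 h; apply: ge_sup.
  by exists ((`|x0 + t *: x0| + `|x0 - t *: x0|) / 2 - 1); exists x0, x0.
move=> _ [x [y [x1 y1 ->]]]; have := h x y x1 y1; lra.
Qed.

Lemma smoothness_modulus_ge0 x0 t : `|x0| = 1 -> 0 <= rho t.
Proof.
move=> x01; have := smoothness_modulus_ub t x01 x01.
have := ler_normD (x0 + t *: x0) (x0 - t *: x0).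
rewrite addrACA subrr addr0 -mulr2n normrMn x01; lra.
Qed.

Lemma smoothness_modulus_ub_norm x z : `|x| = 1 ->
  `|x + z| + `|x - z| <= 2 + 2 * rho `|z|.
Proof.
move=> x1; have [->|z0] := eqVneq z 0.
  rewrite addr0 subr0 x1 normr0; have := smoothness_modulus_ge0 0 x1; lra.
have nz0 : `|z| != 0 by rewrite normr_eq0.
have := @smoothness_modulus_ub x (`|z|^-1 *: z) `|z| x1.
rewrite scalerA mulfV// scale1r; apply.
by rewrite normrZ normfV normr_id mulVf.
Qed.

(** Convexity of the norm along a line: [x + l s y] is a convex combination of [x], of norm 1, and
    [x + s y]. *)
Lemma smoothness_modulus_scale x0 (l : R) t : `|x0| = 1 -> 0 <= l <= 1 ->
  rho (l * t) <= l * rho t.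
Proof.
move=> x01 /andP[l0 l1]; apply: (smoothness_modulus_le x01) => x y x1 y1.
have h s : `|x + (l * s) *: y| <= (1 - l) + l * `|x + s *: y|.
  have -> : x + (l * s) *: y = (1 - l) *: x + l *: (x + s *: y).
    by rewrite scalerDr scalerA addrA -scalerDl subrK scale1r.
  apply: (le_trans (ler_normD _ _)).
  by rewrite !normrZ x1 mulr1 !ger0_norm ?subr_ge0.
have := h t; have := h (- t); rewrite mulrN !scaleNr.
have := smoothness_modulus_ub t x1 y1; nra.
Qed.

Lemma smoothness_modulus_ratio x0 s t : `|x0| = 1 -> 0 < s -> s <= t ->
  rho s / s <= rho t / t.
Proof.
move=> x01 s0 st; have t0 : 0 < t by lra.
rewrite ler_pdivrMr//.
have -> : rho t / t * s = s / t * rho t by field; rewrite gt_eqF.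
have -> : rho s = rho (s / t * t) by rewrite divfK ?gt_eqF.
apply: (smoothness_modulus_scale (l := s / t) t x01).
by rewrite divr_ge0 ?(ltW s0) ?(ltW t0)//= ler_pdivrMr// mul1r.
Qed.

(* Vectors longer than 1 have a smaller relative step, so by convexity the
   unit-sphere modulus still controls their second differences. *)
Lemma second_difference_le z y t : 1 <= `|z| -> `|y| = 1 ->
  `|z + t *: y| + `|z - t *: y| <= 2 * `|z| + 2 * rho t.
Proof.
move=> z1 y1; set N := `|z|; pose x := N^-1 *: z.
have N0 : N != 0 by rewrite gt_eqF// (lt_le_trans ltr01).
have x1 : `|x| = 1 by rewrite /x normrZ normfV normr_id mulVf.
have zE : z = x + (N - 1) *: x.
  by rewrite -[X in X + _]scale1r -scalerDl addrC subrK /x scalerA mulfV ?scale1r.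
have h s : `|z + s *: y| <= `|x + s *: y| + (N - 1).
  rewrite {1}zE addrAC; apply: (le_trans (ler_normD _ _)).
  by rewrite normrZ x1 mulr1 (ger0_norm (_ : 0 <= N - 1)) ?subr_ge0.
have := h t; have := h (- t); rewrite !scaleNr.
have := smoothness_modulus_ub t x1 y1; lra.
Qed.

(* The norm along the line [x + s y] starts at its minimum 1 and must reach
   [s - 1], while its second differences are at most [2 rho t]. *)
Lemma smoothness_modulus_quadratic x y t : `|x| = 1 -> `|y| = 1 ->
  (forall s, 1 <= `|x + s *: y|) -> 0 <= t -> t ^+ 2 <= (8 + 4 * t) * rho t.
Proof.
move=> x1 y1 xy; rewrite le_eqVlt => /predU1P[<-|t0].
  rewrite expr0n/= mulr0 addr0 mulr_ge0//; exact: smoothness_modulus_ge0 x1.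
pose N (k : nat) := `|x + (k%:R * t) *: y|.
have step k : N k.+2 + N k <= 2 * N k.+1 + 2 * rho t.
  have := @second_difference_le (x + (k.+1%:R * t) *: y) y t (xy _) y1.
  rewrite -!addrA -scalerBl -scalerDl -/(N k.+1).
  rewrite (_ : _ + t = k.+2%:R * t); last by rewrite -(natr1 k.+1); ring.
  by rewrite (_ : _ - t = k%:R * t) //; rewrite -(natr1 k); ring.
have N0 : N 0%N = 1 by rewrite /N mul0r scale0r addr0.
have d k : N k.+1 - N k <= 2 * k.+1%:R * rho t.
  elim: k => [|k IH].
    (* The first increment is at most [2 rho t] because the norm at [- t] is at least 1. *)
    have := smoothness_modulus_ub t x1 y1; have := xy (- t).
    rewrite N0 /N mul1r scaleNr; lra.
  have := step k; rewrite -(natr1 k.+1); nra.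
have Nle k : N k <= 1 + k%:R * (k%:R + 1) * rho t.
  elim: k => [|k IH]; first by rewrite N0; lra.
  have := d k; rewrite -(natr1 k); nra.
have rho0 := smoothness_modulus_ge0 t x1.
(* With [4 < n t <= 4 + t], the bounds [n t - 1 <= N n <= 1 + n (n + 1) rho t] give
   [n t <= 2 n (n + 1) rho t]. Cancelling [n] and multiplying by [t] leaves
   [t^2 <= 2 (n t + t) rho t], hence the factor [8 + 4 t]. *)
set n := (Num.truncn (4 / t)).+1.
have n1 : 4 < n%:R * t by rewrite -ltr_pdivrMr// Num.Theory.truncnS_gt.
have n2 : n%:R * t <= 4 + t.
  have : (Num.truncn (4 / t))%:R <= 4 / t.
    by rewrite Num.Theory.truncn_le divr_ge0// ltW.
  by rewrite ler_pdivlMr// /n -natr1; lra.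
have := Nle n.
have : n%:R * t - 1 <= N n.
  have := ler_normB (x + (n%:R * t) *: y) x.
  rewrite addrAC subrr add0r normrZ y1 mulr1 x1 ger0_norm -/(N n); first lra.
  lra.
move: (n%:R : R) n1 n2 (N n) => m m1 m2 M hM1 hM2.
have m0 : 0 < m by nra.
have h : m * t <= 2 * (m * (m + 1) * rho t) by nra.
have {}h : t <= 2 * ((m + 1) * rho t).
  by rewrite -(ler_pM2l m0); apply: (le_trans h); lra.
have : t * t <= 2 * ((m + 1) * rho t) * t by rewrite ler_pM2r.
have : 2 * rho t * (m * t) <= 2 * rho t * (4 + t) by rewrite ler_wpM2l// mulr_ge0.
rewrite expr2; nra.
Qed.

End SmoothnessModulus.

(** * The modulus of convexity and curves on the sphere *)

Section ConvexityModulus.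
Context {R : realType} {X : normedModType R}.
Implicit Types (x y z u v w : X) (e t : R).
Local Notation delta := (convexity_modulus X).

Lemma convexity_modulus_le_pair y z : `|y| = 1 -> `|z| = 1 ->
  delta `|y - z| <= 1 - `|y + z| / 2.
Proof.
move=> y1 z1; apply: ge_inf; last by exists y, z.
exists 0 => _ [u [v [u1 v1 _ ->]]].
have := ler_normD u v; rewrite u1 v1; lra.
Qed.

Lemma convexity_modulus_ge0 e : 0 <= delta e.
Proof.
rewrite /convexity_modulus; set S := (X in inf X).
have lbS : lbound S 0.
  move=> _ [u [v [u1 v1 _ ->]]].
  have := ler_normD u v; rewrite u1 v1; lra.
(* If no two unit vectors are at distance [e], the infimum takes its default value 0. *)
have [->|/set0P S0] := eqVneq S set0; first by rewrite inf0.
exact: lb_le_inf.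
Qed.

Lemma convexity_modulus0 : delta 0 = 0.
Proof.
apply/eqP; rewrite eq_le convexity_modulus_ge0 andbT.
have [[y y1]|nX] := pselect (exists y : X, `|y| = 1).
  have := convexity_modulus_le_pair y1 y1.
  rewrite subrr normr0 -mulr2n normrMn y1; lra.
rewrite /convexity_modulus (_ : [set _ | _] = set0) ?inf0//.
by apply/seteqP; split=> // r [y [_ [y1 _ _ _]]]; apply: nX; exists y.
Qed.

Lemma convexity_modulus_le_half e : 0 <= e -> delta e <= e / 2.
Proof.
move=> e0; have [[y [z [y1 z1 <-]]]|nX] :=
    pselect (exists y z : X, [/\ `|y| = 1, `|z| = 1 & `|y - z| = e]).
  apply: (le_trans (convexity_modulus_le_pair y1 z1)).
  have := ler_normD (y + z) (y - z).
  rewrite addrACA subrr addr0 -mulr2n normrMn y1; lra.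
rewrite /convexity_modulus (_ : [set _ | _] = set0) ?inf0 ?divr_ge0//.
apply/seteqP; split=> // r [y [z [y1 z1 yz _]]].
by apply: nX; exists y, z.
Qed.

(** The intermediate value theorem for the distance from [x] to the normalized curve; avoiding 0
    keeps the normalization continuous. *)
Lemma sphere_arc_IVT x (gamma : R -> X) e :
  (forall s, 0 <= s <= 1 -> gamma s != 0) ->
  continuous gamma -> `|gamma 0| = 1 -> `|gamma 1| = 1 ->
  `|x - gamma 0| <= e <= `|x - gamma 1| ->
  exists2 s, 0 <= s <= 1 & `|x - `|gamma s|^-1 *: gamma s| = e.
Proof.
move=> gamma0 gammac g0 g1 xe.
pose f s := `|x - `|gamma s|^-1 *: gamma s|.
have [||s] := @IVT R f 0 1 e ler01.
- apply: continuous_in_subspaceT => s; rewrite inE/= in_itv/= => /gamma0 gs.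
  apply: cvg_norm; apply: cvgB; first exact: cvg_cst.
  apply: cvgZ; last exact: gammac.
  apply: cvgV; first by rewrite normr_eq0.
  by apply: cvg_norm; exact: gammac.
- rewrite /f g0 g1 invr1 !scale1r ge_min le_max.
  by case/andP: xe => -> ->; rewrite orbT.
- by rewrite in_itv/= => s01 fs; exists s.
Qed.

End ConvexityModulus.

(** * Evaluation and norm of functionals *)

Section DualEvaluation.
Context {R : realType} {X : normedModType R}.
Implicit Types (f g : dual X) (x y : X) (a : R).

Lemma dual_evalD f x y : (f (x + y) : R) = (f x : R) + (f y : R).
Proof. exact: linearD. Qed.

Lemma dual_evalB f x y : (f (x - y) : R) = (f x : R) - (f y : R).
Proof. exact: linearB. Qed.

Lemma dual_evalZ f a x : (f (a *: x) : R) = a * (f x : R).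
Proof. exact: linearZ. Qed.

Lemma dual_addE f g x : ((f + g) x : R) = (f x : R) + (g x : R).
Proof. by []. Qed.

Lemma dual_scaleE a f x : ((a *: f) x : R) = a * (f x : R).
Proof. by []. Qed.

Lemma dual_eval_le f x : (f x : R) <= `|f| * `|x|.
Proof. exact: le_trans (ler_norm _) (dual_norm_ub f x). Qed.

(** The sphere is symmetric, so a one-sided bound is enough; [x0] yields [0 <= M], which extends the
    bound to the ball. *)
Lemma dual_norm_le f M x0 : `|x0| = 1 ->
  (forall x, `|x| = 1 -> (f x : R) <= M) -> `|f| <= M.
Proof.
move=> x01 fM; have M0 : 0 <= M.
  have := fM x0 x01; have /fM : `|(- 1) *: x0| = 1 by rewrite normrZ x01 normrN1 mulr1.
  rewrite dual_evalZ; lra.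
apply: ge_sup; first exact: (dual_norm_has_sup f).1.
move=> _ [x /= x1 <-]; have [->|x0'] := eqVneq x 0; first by rewrite linear0 normr0.
have nx0 : 0 < `|x| by rewrite normr_gt0.
have h a : `|a| = 1 -> a * (f x : R) <= M.
  move=> a1; have /fM : `|(a / `|x|) *: x| = 1.
    by rewrite normrZ normrM a1 mul1r normfV normr_id mulVf// gt_eqF.
  rewrite dual_evalZ -mulrA mulrCA ler_pdivrMl// => /le_trans; apply.
  by rewrite ler_piMl.
rewrite ler_norml -[- M <= _]lerN2 opprK -mulN1r h ?normrN1//= -[X in X <= _]mul1r.
by rewrite h ?normr1.
Qed.

Lemma continuous_segment x y : continuous (fun s : R => (1 - s) *: x + s *: y).
Proof.
move=> s; apply: cvgD.
  apply: cvgZr_tmp; apply: cvgB; first exact: cvg_cst.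
  exact: cvg_id.
by apply: cvgZr_tmp; exact: cvg_id.
Qed.

End DualEvaluation.

(** * Arcs of the sphere ending at a point [w] supported by [g] *)

Section SupportedArcs.
Context {R : realType} {X : normedModType R}.
Variables (g : dual X) (w : X).
Hypotheses (g1 : `|g| = 1) (w1 : `|w| = 1) (gw : (g w : R) = 1).
Implicit Types (u v : X) (e s : R).
Local Notation delta := (convexity_modulus X).
Local Notation gamma u s := ((1 - s) *: w + s *: u).

Let g_le x : (g x : R) <= `|x|.
Proof. by have := dual_eval_le g x; rewrite g1 mul1r. Qed.

Let g_gamma u s : (g (gamma u s) : R) = 1 - s + s * (g u : R).
Proof. by rewrite dual_evalD !dual_evalZ gw mulr1. Qed.

Let gamma_ge u s : `|u| = 1 -> 0 <= s <= 1 -> 2 * s - 1 <= `|gamma u s|.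
Proof.
move=> u1 /andP[s0 s1].
have := ler_normB (gamma u s) ((1 - s) *: w).
rewrite addrAC subrr add0r !normrZ u1 w1 !mulr1 !ger0_norm ?subr_ge0//; lra.
Qed.

Let gamma_le u s : `|u| = 1 -> 0 <= s <= 1 -> `|gamma u s| <= 1.
Proof.
move=> u1 /andP[s0 s1]; apply: (le_trans (ler_normD _ _)).
by rewrite !normrZ u1 w1 !mulr1 !ger0_norm ?subr_ge0//; lra.
Qed.

(** At a zero of the segment the two lower bounds for its norm force [s = 1/2], and then
    [g u <= -1]. *)
Let gamma_gt0 u s : `|u| = 1 -> -1 < (g u : R) -> 0 <= s <= 1 ->
  0 < `|gamma u s|.
Proof.
move=> u1 gu s01.
have h1 := gamma_ge u1 s01.
have := g_le (gamma u s); rewrite g_gamma => h2.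
rewrite lt_neqAle normr_ge0 andbT eq_sym; apply/eqP => N0.
rewrite N0 in h1 h2; case/andP: s01 => s0 s1.
have h3 : 0 <= s * (1 + (g u : R)) by apply: mulr_ge0 => //; lra.
have s2 : s = 1 / 2 by lra.
by rewrite s2 in h2; lra.
Qed.

Let arc_point u x e : `|u| = 1 -> -1 < (g u : R) -> `|x - w| <= e <= `|x - u| ->
  exists2 s, 0 <= s <= 1 & `|x - `|gamma u s|^-1 *: gamma u s| = e.
Proof.
move=> u1 gu xe; apply: (@sphere_arc_IVT _ _ x (fun s => gamma u s)).
- by move=> s s01; rewrite -normr_gt0 gamma_gt0.
- exact: continuous_segment.
- by rewrite subr0 scale1r scale0r addr0.
- by rewrite subrr scale1r scale0r add0r.
- by rewrite subr0 subrr !scale1r !scale0r addr0 add0r.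
Qed.

(** Replacing [|x + y|] by the smaller value [g (x + y)] splits the midpoint defect into one term
    for each vector. *)
Lemma convexity_modulus_le_eval x y : `|x| = 1 -> `|y| = 1 ->
  delta `|x - y| <= 1 - ((g x : R) + (g y : R)) / 2.
Proof.
move=> x1 y1; apply: (le_trans (convexity_modulus_le_pair x1 y1)).
have := g_le (x + y); rewrite dual_evalD; lra.
Qed.

(* The slope [(1 - g y) / |w - y|] does not increase when [y] moves along the
   arc from [u] to [w]. *)
Lemma convexity_modulus_slope u e : `|u| = 1 -> -1 < (g u : R) ->
  0 <= e <= `|w - u| -> 2 * delta e * `|w - u| <= e * (1 - (g u : R)).
Proof.
move=> u1 gu /andP[e0 eu]; set a := `|w - u|.
have [|s s01 se] := @arc_point u w e u1 gu; first by rewrite subrr normr0 e0.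
have N0 := gamma_gt0 u1 gu s01; have N1 := gamma_le u1 s01.
set N := `|gamma u s| in se N0 N1; set y := N^-1 *: gamma u s in se.
have y1 : `|y| = 1 by rewrite /y normrZ normfV (normr_id (gamma u s)) mulVf// gt_eqF.
have := convexity_modulus_le_eval w1 y1; rewrite se gw => d1.
have gy : N * (g y : R) = 1 - s + s * (g u : R).
  by rewrite /y dual_evalZ mulrA mulfV ?mul1r ?g_gamma// gt_eqF.
have ua : 1 - (g u : R) <= a by have := g_le (w - u); rewrite dual_evalB gw.
have Ne : s * a - (1 - N) <= N * e.
  have -> : N * e = `|N *: w - gamma u s|.
    rewrite -se -[in LHS](ger0_norm (ltW N0)) -normrZ scalerBr /y scalerA mulfV ?scale1r//.
    by rewrite gt_eqF.
  have := ler_normD (N *: w - gamma u s) ((1 - N) *: w).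
  have -> : N *: w - gamma u s + (1 - N) *: w = s *: (w - u).
    rewrite addrAC -scalerDl [N + _]addrC subrK scalerBl scalerBr scale1r.
    by rewrite opprD opprB addrA [w + _]addrC subrK.
  case/andP: s01 => s0 s1.
  rewrite !normrZ w1 mulr1 (ger0_norm s0) ger0_norm ?subr_ge0// -/a; lra.
(* Here [N (1 - g y) = s (1 - g u) - (1 - N)]; the terms in [1 - N] compare by [1 - g u <= a]. *)
have h : N * (1 - (g y : R)) * a <= N * (e * (1 - (g u : R))).
  rewrite mulrBr mulr1 gy.
  have : (s * a - (1 - N)) * (1 - (g u : R)) <= N * e * (1 - (g u : R)).
    apply: ler_wpM2r => //; have := g_le u; rewrite u1; lra.
  have : (1 - N) * (1 - (g u : R)) <= (1 - N) * a by apply: ler_wpM2l; lra.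
  lra.
have {}h : (1 - (g y : R)) * a <= e * (1 - (g u : R)).
  by rewrite -(ler_pM2l N0) mulrA.
apply: le_trans h; apply: ler_wpM2r; [exact: normr_ge0|lra].
Qed.

(** Moving [v] along the arc towards [w] reaches a point [y] at distance exactly [e] from [u], and
    [g y >= g v] there. *)
Lemma convexity_modulus_shrink u v e : `|u| = 1 -> `|v| = 1 -> -1 < (g v : R) ->
  `|u - w| <= e <= `|u - v| -> delta e <= 1 - ((g u : R) + (g v : R)) / 2.
Proof.
move=> u1 v1 gv ue.
have [s s01 se] := @arc_point v u e v1 gv ue.
have N0 := gamma_gt0 v1 gv s01; have N1 := gamma_le v1 s01.
have N2 := gamma_ge v1 s01.
set N := `|gamma v s| in se N0 N1 N2; set y := N^-1 *: gamma v s in se.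
have y1 : `|y| = 1 by rewrite /y normrZ normfV (normr_id (gamma v s)) mulVf// gt_eqF.
have := convexity_modulus_le_eval u1 y1; rewrite se => d1.
have gy : N * (g y : R) = 1 - s + s * (g v : R).
  by rewrite /y dual_evalZ mulrA mulfV ?mul1r ?g_gamma// gt_eqF.
suff : (g v : R) <= (g y : R) by lra.
rewrite -(ler_pM2l N0) gy; case/andP: s01 => s0 s1.
have := g_le v; rewrite v1; move: (g v : R) gv => c c1 c2.
(* For [c >= 0] use [N <= 1] and [c <= 1]; for [c < 0] use [N >= 2 s - 1] and [c > -1]. *)
have [c0|c0] := leP 0 c; nra.
Qed.

End SupportedArcs.

(** * Growth of the modulus of convexity *)

Section ConvexityModulusGrowth.
Context {R : realType} {X : normedModType R}.
Implicit Types (u v : X) (e : R).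
Local Notation delta := (convexity_modulus X).

(* A weak form of the monotonicity of [delta e / e], for which the infimum over
   the sphere need not be compared with the one over the ball: each of [u], [v]
   is joined by an arc of the sphere to the normalized midpoint [w]. *)
Lemma convexity_modulus_growth u v e :
  (forall w : X, `|w| = 1 -> exists2 g : dual X, `|g| = 1 & (g w : R) = 1) ->
  `|u| = 1 -> `|v| = 1 -> 0 < e <= `|u - v| ->
  (`|u - v| - e) * delta e <= e * (1 - `|u + v| / 2).
Proof.
move=> supp u1 v1 /andP[e0 euv].
have d0 := @convexity_modulus_ge0 _ X e.
(* Antipodal vectors have no normalized midpoint; for them [delta e <= e / 2] is enough. *)
have [uv0|uv0] := eqVneq (u + v) 0.
  have vE : v = - u by apply/eqP; rewrite -addr_eq0 addrC uv0.
  have uv2 : `|u - v| = 2 by rewrite vE opprK -mulr2n normrMn u1.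
  rewrite uv2 uv0 normr0.
  by have := @convexity_modulus_le_half _ X e (ltW e0); nra.
set m := `|u + v|; have m0 : 0 < m by rewrite normr_gt0.
pose w := m^-1 *: (u + v).
have w1 : `|w| = 1 by rewrite normrZ normfV (normr_id (u + v)) mulVf// gt_eqF.
have [g g1 gw] := supp w w1.
have guv : (g u : R) + (g v : R) = m.
  rewrite -dual_evalD -[u + v](@scalerKV _ _ m); last by rewrite gt_eqF.
  by rewrite dual_evalZ -/w gw mulr1.
have gu1 : (g u : R) <= 1 by have := dual_eval_le g u; rewrite g1 u1 mul1r.
have gv1 : (g v : R) <= 1 by have := dual_eval_le g v; rewrite g1 v1 mul1r.
have gu : -1 < (g u : R) by lra.
have gv : -1 < (g v : R) by lra.
have tri : `|u - v| <= `|w - u| + `|w - v|.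
  have -> : u - v = (w - v) - (w - u) by rewrite opprB [RHS]addrC addrA subrK.
  by rewrite [leRHS]addrC ler_normB.
have slope x := @convexity_modulus_slope _ _ g w g1 w1 gw x e.
(* If both vectors are at distance at least [e] from [w], the slope estimates add up. If only one
   is, its distance to [w] exceeds [|u - v| - e]. If neither is, [|u - v| < 2 e] and the arc is
   shrunk. *)
have [ea|ae] := leP e `|w - u|; have [eb|be] := leP e `|w - v|.
- have := slope u u1 gu; have := slope v v1 gv.
  rewrite ea eb (ltW e0) => /(_ isT) h1 /(_ isT) h2; nra.
- have := slope u u1 gu; rewrite ea (ltW e0) => /(_ isT) h2; nra.
- have := slope v v1 gv; rewrite eb (ltW e0) => /(_ isT) h2; nra.
- have := convexity_modulus_shrink g1 w1 gw u1 v1 gv (e := e).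
  rewrite [in `|u - w|]distrC (ltW ae) euv guv => /(_ isT) h; nra.
Qed.
End ConvexityModulusGrowth.

(** * Support functionals and smoothness of the dual *)

Section SupportFunctionals.
Context {R : realType} {X : normedModType R}.
Implicit Types (x y w : X) (f g h : dual X) (p s t : R).

(** The conclusion of Hahn-Banach at unit vectors; the given selection of the duality mapping
    supplies it. *)
Definition has_support_functionals :=
  forall w, `|w| = 1 -> exists2 g : dual X, `|g| = 1 & (g w : R) = 1.

Lemma duality_selection_unit p (j : X -> dual X) x :
  duality_selection p j -> `|x| = 1 -> `|j x| = 1 /\ (j x x : R) = 1.
Proof.
move=> hj x1; have [jxx jx] :
  (j x x : R) = `|j x| * `|x| /\ `|j x| = `|x| `^ (p - 1) := hj x.
by rewrite jxx jx x1 powR1 mulr1.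
Qed.

Lemma duality_selection_support p (j : X -> dual X) :
  duality_selection p j -> has_support_functionals.
Proof.
by move=> hj w /(duality_selection_unit hj)[jw jww]; exists (j w).
Qed.

Lemma dual_eval_le_norm g x : `|g| = 1 -> (g x : R) <= `|x|.
Proof. by move=> g1; have := dual_eval_le g x; rewrite g1 mul1r. Qed.

Lemma norm_normalize x : x != 0 -> `| `|x|^-1 *: x| = 1.
Proof. by move=> x0; rewrite normrZ normfV normr_id mulVf// normr_eq0. Qed.

Lemma dim_ge2_unit : dim_ge2 X -> exists x, `|x| = 1.
Proof.
move=> [x [y xy]]; have [x0|x0] := eqVneq x 0; last first.
  by exists (`|x|^-1 *: x); exact: norm_normalize.
have [|/eqP] := xy 1 0; first by rewrite x0 scaler0 scale0r addr0.
by rewrite oner_eq0.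
Qed.

Lemma dim_ge2_kernel g : dim_ge2 X -> exists2 y, `|y| = 1 & (g y : R) = 0.
Proof.
move=> [a [b ab]].
suff [y y0 gy] : exists2 y, y != 0 & (g y : R) = 0.
  by exists (`|y|^-1 *: y); [exact: norm_normalize|rewrite dual_evalZ gy mulr0].
have [ga|ga] := eqVneq (g a : R) 0.
  exists a => //; apply/eqP => a0.
  have [|/eqP] := ab 1 0; first by rewrite a0 scaler0 scale0r addr0.
  by rewrite oner_eq0.
exists ((g b : R) *: a - (g a : R) *: b).
  apply/eqP; rewrite -scaleNr => /ab[_ /eqP]; rewrite oppr_eq0.
  by rewrite (negbTE ga).
by rewrite dual_evalB !dual_evalZ mulrC subrr.
Qed.

(** If [g] supports the ball at [x] and kills [y], then [g] keeps the norm at least 1 on the line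
    [x + s y]. A second dimension provides [y]. *)
Lemma smoothness_modulus_quadratic_space t : dim_ge2 X ->
  has_support_functionals -> 0 <= t ->
  t ^+ 2 <= (8 + 4 * t) * smoothness_modulus X t.
Proof.
move=> X2 supp t0; have [x x1] := dim_ge2_unit X2.
have [g g1 gx] := supp x x1; have [y y1 gy] := dim_ge2_kernel g X2.
apply: (smoothness_modulus_quadratic x1 y1) => // s.
have := dual_eval_le_norm (x + s *: y) g1.
by rewrite dual_evalD dual_evalZ gx gy mulr0 addr0.
Qed.

(** Evaluation at [x] supports the dual ball at [f]. The direction is [h - h(x) f], which vanishes
    at [x] and takes the value 1 at [y]. *)
Lemma smoothness_modulus_quadratic_dual t : dim_ge2 X ->
  has_support_functionals -> 0 <= t ->
  t ^+ 2 <= (8 + 4 * t) * smoothness_modulus (dual X) t.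
Proof.
move=> X2 supp t0; have [x x1] := dim_ge2_unit X2.
have [f f1 fx] := supp x x1; have [y y1 fy] := dim_ge2_kernel f X2.
have [h h1 hy] := supp y y1.
pose g : dual X := h - (h x : R) *: f.
have gE z : (g z : R) = (h z : R) - (h x : R) * (f z : R) by [].
have g0 : g != 0.
  apply/eqP => g0; have := gE y; rewrite hy fy mulr0 subr0 g0 => /esym/eqP.
  by rewrite (_ : ((0 : dual X) y : R) = 0)// oner_eq0.
have gx : (g x : R) = 0 by rewrite gE fx mulr1 subrr.
have gn1 : `| `|g|^-1 *: g| = 1.
  by rewrite normrZ normfV normr_id mulVf// normr_eq0.
apply: (smoothness_modulus_quadratic f1 gn1) => // s.
have := dual_eval_le (f + s *: (`|g|^-1 *: g)) x.
by rewrite dual_addE !dual_scaleE fx gx !mulr0 addr0 x1 mulr1.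
Qed.

(** The two dual norms test to [f (x + y) + s g (x - y) <= |x + y| + s |x - y|], where [s e = 2 d].
    Pairs closer than [e] have [s |x - y| <= 2 d]; the others are covered by
    [convexity_modulus_growth]. *)
Lemma smoothness_modulus_dual_le e : has_support_functionals ->
  (exists x : X, `|x| = 1) -> 0 < e ->
  smoothness_modulus (dual X) (2 * convexity_modulus X e / e) <=
    convexity_modulus X e.
Proof.
move=> supp [x0 x01] e0; set d := convexity_modulus X e.
have d0 : 0 <= d := convexity_modulus_ge0 e.
set s := 2 * d / e.
have s0 : 0 <= s by rewrite divr_ge0// ?mulr_ge0// ltW.
have se : s * e = 2 * d by rewrite divfK// gt_eqF.
have [f0 f01 _] := supp x0 x01.
apply: (smoothness_modulus_le f01) => f g f1 g1.
have key x y : `|x| = 1 -> `|y| = 1 ->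
    ((f + s *: g) x : R) + ((f - s *: g) y : R) <= 2 + 2 * d.
  move=> x1 y1.
  rewrite [X in _ + X](_ : _ = (f y : R) - s * (g y : R))// dual_addE dual_scaleE.
  have h1 := dual_eval_le_norm (x + y) f1; rewrite dual_evalD in h1.
  have h2 := dual_eval_le_norm (x - y) g1; rewrite dual_evalB in h2.
  have h3 : `|x + y| <= 2 by have := ler_normD x y; rewrite x1 y1.
  suff : s * `|x - y| <= 2 + 2 * d - `|x + y|.
    have := ler_wpM2l s0 h2; lra.
  have [le|le] := ltP `|x - y| e.
    have := ler_wpM2l s0 (ltW le); rewrite se; lra.
  have := convexity_modulus_growth supp x1 y1 (e := e).
  rewrite e0 le -/d => /(_ isT) h.
  rewrite -(ler_pM2r e0) mulrAC se; lra.
have h1 : `|f + s *: g| <= 2 + 2 * d - `|f - s *: g|.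
  apply: (dual_norm_le x01) => x x1; rewrite lerBrDr -lerBrDl.
  apply: (dual_norm_le x01) => y y1; have := key x y x1 y1; lra.
lra.
Qed.

End SupportFunctionals.

(** * Bregman distances of powers of the norm *)

Section PowerBregman.
Context {R : realType}.
Implicit Types (p s t : R).

(** The summand 2 comes from the modulus itself; the other absorbs the second-order term through the
    quadratic lower bound. It involves no space, so it also serves the dual. *)
Definition smoothness_const t p : R := 2 + powR_quadratic_const t p * (8 + 4 * t).

Lemma smoothness_const_gt0 t p : 0 <= t -> 1 < p -> 0 < smoothness_const t p.
Proof.
move=> t0 /(powR_quadratic_const_ge2 t); rewrite /smoothness_const; nra.
Qed.

(* Here [s] stands for the value at [z] of a functional supporting the ball
   at [x]; the only trace of it that matters is [1 - s <= `|x - z|]. *)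
Lemma bregman_le_smoothness (E : normedModType R) (x z : E) s T p : 1 < p ->
  `|z| ^+ 2 <= (8 + 4 * `|z|) * smoothness_modulus E `|z| ->
  `|x| = 1 -> `|z| <= T -> 1 - s <= `|x - z| ->
  p^-1 * `|x + z| `^ p - p^-1 - s <=
    smoothness_const T p * smoothness_modulus E `|z|.
Proof.
move=> p1 quad x1 zT sxz.
have := smoothness_modulus_ub_norm z x1.
have rho0 := smoothness_modulus_ge0 `|z| x1.
set rho := smoothness_modulus E `|z| in quad rho0 *.
have K2 := powR_quadratic_const_ge2 T p1.
set K := powR_quadratic_const T p in K2.
set a := `|x + z|; move=> ub.
have a0 : 0 <= a := normr_ge0 _.
have a1 : a <= 1 + `|z| by rewrite -x1 ler_normD.
have a2 : 1 - `|z| <= a by have := ler_normB (x + z) z; rewrite addrK x1 -/a; lra.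
have := @powR_quadratic _ a T p; rewrite a0 (le_trans a1) ?lerD2l// -/K => /(_ isT p1) h.
have asq : (a - 1) ^+ 2 <= `|z| ^+ 2.
  by rewrite -[leLHS]real_normK ?num_real// lerXn2r ?nnegrE// ler_norml; lra.
have h2 : (8 + 4 * `|z|) * rho <= (8 + 4 * T) * rho.
  by rewrite ler_wpM2r// lerD2l ler_pM2l.
have h3 : K * (a - 1) ^+ 2 <= K * ((8 + 4 * T) * rho).
  by rewrite ler_wpM2l//; lra.
rewrite /smoothness_const -/K; lra.
Qed.

Lemma bregman_norm_powerE (X : normedModType R) p (xi : dual X) (x y : X) :
  1 < p -> `|x| = 1 -> `|xi| = 1 -> (xi x : R) = 1 ->
  (`|bregman (norm_power p) xi y x| =
    (p^-1 * `|y| `^ p - p^-1 - (xi (y - x) : R))%:E)%E.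
Proof.
move=> p1 x1 xi1 xix; rewrite /bregman /norm_power x1 powR1 mulr1 -!EFinB abse_EFin.
rewrite ger0_norm// dual_evalB xix.
have := dual_eval_le_norm y xi1; have := powR_bernoulli (normr_ge0 y) p1.
have p0 : 0 < p^-1 by rewrite invr_gt0; lra.
move=> /(ler_wpM2l (ltW p0)); rewrite mulrDr mulr1 mulrA mulVf ?mul1r; first by lra.
by rewrite gt_eqF//; lra.
Qed.

(** Young's inequality bounds [(f + s h) y] by the two powers; the constants cancel by
    [1/p + 1/p' = 1 = f x]. *)
Lemma bregman_conjugate_ge (X : normedModType R) p p' (f h : dual X) (x y : X) s :
  1 < p -> 1 < p' -> p^-1 + p'^-1 = 1 -> (f x : R) = 1 ->
  s * (h (y - x) : R) -
    (p'^-1 * `|f + s *: h| `^ p' - p'^-1 - s * (h x : R)) <=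
  p^-1 * `|y| `^ p - p^-1 - (f (y - x) : R).
Proof.
move=> p1 p'1 pp' fx.
have [p0 p'0] : 0 < p /\ 0 < p' by lra.
have := conjugate_powR (normr_ge0 y) (normr_ge0 (f + s *: h)) p0 p'0 pp'.
have := dual_eval_le (f + s *: h) y.
rewrite dual_addE dual_scaleE !dual_evalB fx; lra.
Qed.

End PowerBregman.

(** * Lower bounds for Bregman distances and uniform convexity *)

Section ConvexityOfNormPower.
Context {R : realType} {X : normedModType R}.
Implicit Types (x y z : X) (f h : dual X) (p t T e : R).
Local Notation delta := (convexity_modulus X).

Lemma bregman_ge_convexity p p' f x y T :
  dim_ge2 X -> has_support_functionals (X := X) ->
  1 < p -> 1 < p' -> p^-1 + p'^-1 = 1 ->
  `|x| = 1 -> `|f| = 1 -> (f x : R) = 1 -> 0 < T ->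
  `|x - y| <= smoothness_const T p' * (smoothness_modulus (dual X) T / T) ->
  smoothness_const T p' * delta (`|x - y| / smoothness_const T p') <=
    p^-1 * `|y| `^ p - p^-1 - (f (y - x) : R).
Proof.
move=> X2 supp p1 p'1 pp' x1 f1 fx T0.
have C0 := smoothness_const_gt0 (ltW T0) p'1.
set C := smoothness_const T p' in C0 *; set t := `|x - y|.
have [t0|t0] := eqVneq t 0.
  move: t0; rewrite /t => /eqP; rewrite normr_eq0 subr_eq0 => /eqP <- _.
  rewrite subrr normr0 mul0r convexity_modulus0 mulr0 x1 powR1 mulr1 subrr.
  by rewrite (_ : (f 0 : R) = 0) ?subrr//; exact: linear0.
have {}t0 : 0 < t by rewrite lt_neqAle eq_sym t0 normr_ge0.
move=> tT; set e := t / C; have e0 : 0 < e by rewrite divr_gt0.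
have eT : e <= smoothness_modulus (dual X) T / T.
  by rewrite ler_pdivrMr// mulrC.
set d := delta e; have d0 : 0 <= d := convexity_modulus_ge0 e.
pose s := 2 * d / e.
have s0 : 0 <= s by apply: divr_ge0; [exact: mulr_ge0|exact: ltW].
have se : s * e = 2 * d by rewrite /s divfK// gt_eqF.
have rho_s : smoothness_modulus (dual X) s <= d.
  by apply: smoothness_modulus_dual_le => //; exists x.
(* The restriction on [t] enters here: if [T < s], monotonicity of [rho s / s] gives
   [e <= rho s / s], so [2 d = s e <= rho s <= d], hence [d = 0] and [s = 0]. *)
have sT : s <= T.
  rewrite leNgt; apply/negP => Ts; have sgt0 := lt_trans T0 Ts.
  have := smoothness_modulus_ratio f1 T0 (ltW Ts).
  move=> /(le_trans eT); rewrite ler_pdivlMr// mulrC se => /le_trans /(_ rho_s) h.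
  have d0' : d = 0.
    by apply/eqP; rewrite eq_le d0 andbT; move: h; rewrite mulr_natl mulr2n gerDl.
  by move: sgt0; rewrite /s d0' mulr0 mul0r ltxx.
have yx : `|y - x| = t by rewrite distrC.
have [h h1 hyx] : exists2 h : dual X, `|h| = 1 & (h (y - x) : R) = t.
  have yx0 : y - x != 0 by rewrite -normr_gt0 yx.
  have [h h1 hyx] := supp _ (norm_normalize yx0).
  exists h => //; move: hyx; rewrite dual_evalZ yx => /(congr1 ( *%R t)).
  by rewrite mulrA mulfV ?mul1r ?mulr1// gt_eqF.
apply: le_trans (bregman_conjugate_ge h y s p1 p'1 pp' fx).
have sh : `|s *: h| = s by rewrite normrZ h1 mulr1 ger0_norm.
have := @bregman_le_smoothness R (dual X) f (s *: h) (s * (h x : R)) T p' p'1.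
rewrite sh => /(_ (smoothness_modulus_quadratic_dual X2 supp s0) f1 sT) H.
have {}H : p'^-1 * `|f + s *: h| `^ p' - p'^-1 - s * (h x : R) <=
    C * smoothness_modulus (dual X) s.
  apply: H; have := dual_eval_le (f - s *: h) x.
  by rewrite [X in X <= _](_ : _ = (f x : R) - s * (h x : R))// fx x1 mulr1.
rewrite hyx; have tE : t = C * e by rewrite /e mulrC divfK// gt_eqF.
have -> : s * t = C * (2 * d) by rewrite tE mulrCA se.
apply: le_trans (lerB (lexx _) (le_trans H (ler_wpM2l (ltW C0) rho_s))).
by rewrite -mulrBr mulr_natl mulr2n addrK.
Qed.

(** The curve runs from [x] to [- x], bent by [u] so as to miss 0. It makes the set under the
    infimum in [convexity_modulus] nonempty. *)
Lemma unit_pair_at_distance e : dim_ge2 X -> has_support_functionals (X := X) ->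
  0 <= e <= 2 -> exists x y, [/\ `|x| = 1, `|y| = 1 & `|x - y| = e].
Proof.
move=> X2 supp /andP[e0 e2]; have [x x1] := dim_ge2_unit X2.
have [g g1 gx] := supp x x1; have [u u1 gu] := dim_ge2_kernel g X2.
pose gamma s : X := (1 - 2 * s) *: x + (s * (1 - s)) *: u.
have gamma0 s : gamma s != 0.
  apply/eqP => gs0; have : (g (gamma s) : R) = 0 by rewrite gs0; exact: linear0.
  rewrite dual_evalD !dual_evalZ gx gu => h.
  have s2 : s = 1 / 2 by lra.
  have : `|gamma s| = 0 by rewrite gs0 normr0.
  rewrite /gamma s2 (_ : 1 - 2 * (1 / 2) = 0); last by field.
  by rewrite scale0r add0r normrZ u1 mulr1 ger0_norm; lra.
have [|||||s s01 hs] := @sphere_arc_IVT _ _ x gamma e.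
- by [].
- move=> s; apply: cvgD; apply: cvgZr_tmp.
    apply: cvgB; first exact: cvg_cst.
    by apply: cvgM; [exact: cvg_cst|exact: cvg_id].
  apply: cvgM; first exact: cvg_id.
  by apply: cvgB; [exact: cvg_cst|exact: cvg_id].
- by rewrite /gamma mulr0 subr0 mul0r scale0r scale1r addr0.
- rewrite /gamma subrr mulr0 scale0r addr0 normrZ x1 !mulr1.
  by rewrite (_ : 1 - 2 = -1) ?normrN1//; ring.
- rewrite /gamma mulr0 subr0 mul0r scale0r scale1r addr0 subrr normr0 e0/=.
  rewrite subrr !mulr0 scale0r addr0 (_ : 1 - 2 * 1 = -1); last by ring.
  by rewrite scaleN1r opprK -mulr2n normrMn x1.
by exists x, (`|gamma s|^-1 *: gamma s); split=> //; exact: norm_normalize.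
Qed.

(* The midpoint of two unit vectors at distance [e], projected on the sphere,
   is at distance at least [e / 2] from one of them, and the Bregman distances
   to both add up to twice the defect of the midpoint. *)
Lemma uniformly_convex_of_bregman p T (phi : R -> R) (j : X -> dual X) :
  dim_ge2 X -> 1 < p -> duality_selection p j -> 0 < T ->
  (forall t, 0 < t -> 0 < phi t) ->
  (forall x y, `|x| = 1 -> `|x - y| <= T ->
    phi `|x - y| <= p^-1 * `|y| `^ p - p^-1 - (j x (y - x) : R)) ->
  uniformly_convex X.
Proof.
move=> X2 p1 hj T0 phi0 hphi e /andP[e0 e2].
have supp := duality_selection_support hj.
set t := Num.min T (e / 2).
have t0 : 0 < t by rewrite lt_min T0 divr_gt0.
have tT : t <= T by rewrite ge_min lexx.
have te : t <= e / 2 by rewrite ge_min lexx orbT.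
(* The hypothesis is applied at the point [y'] of the segment from [x] to [y] at distance [t] from
   [x]. Since [|y'| <= 1], the power terms contribute at most 0. *)
have sphere x y : `|x| = 1 -> `|y| = 1 -> e / 2 <= `|x - y| ->
    phi t <= 1 - (j x y : R).
  move=> x1 y1 xy; have [jx jxx] := duality_selection_unit hj x1.
  have xy0 : 0 < `|x - y| by lra.
  pose l := t / `|x - y|.
  have l0 : 0 < l by rewrite divr_gt0.
  have l1 : l <= 1 by rewrite ler_pdivrMr// mul1r; lra.
  pose y' := x + l *: (y - x).
  have xy' : `|x - y'| = t.
    rewrite /y' opprD addrA subrr sub0r normrN normrZ gtr0_norm//.
    by rewrite [`|y - x|]distrC divfK// gt_eqF.
  have y'1 : `|y'| <= 1.
    have -> : y' = (1 - l) *: x + l *: y.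
      by rewrite /y' scalerBr scalerBl scale1r addrA addrAC.
    apply: (le_trans (ler_normD _ _)).
    by rewrite 2!normrZ x1 y1 !mulr1 (ger0_norm (ltW l0)) ger0_norm ?subr_ge0// subrK.
  have := hphi x y' x1; rewrite xy' => /(_ tT) h.
  have y'p : `|y'| `^ p <= 1.
    rewrite -[leRHS](_ : 1 `^ p = 1); last by rewrite powR1.
    by apply: ge0_ler_powR; rewrite ?nnegrE//; lra.
  have p0 : 0 < p^-1 by rewrite invr_gt0; lra.
  have := ler_wpM2l (ltW p0) y'p; rewrite mulr1.
  have jy1 : (j x y : R) <= 1 by have := dual_eval_le_norm y jx; rewrite y1.
  have jy' : (j x (y' - x) : R) = l * ((j x y : R) - 1).
    by rewrite /y' addrC addKr dual_evalZ dual_evalB jxx.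
  rewrite jy' in h; nra.
(* The value 1 is the defect of an antipodal pair. *)
apply: (@lt_le_trans _ _ (Num.min 1 (phi t / 2))).
  by rewrite lt_min ltr01 divr_gt0// phi0.
apply: lb_le_inf.
  have [|x [y [x1 y1 xy]]] := unit_pair_at_distance (e := e) X2 supp.
    by rewrite (ltW e0).
  by exists (1 - `|x + y| / 2), x, y.
move=> _ [y [z [y1 z1 yz ->]]]; rewrite ge_min.
have [yz0|yz0] := eqVneq (y + z) 0.
  by rewrite yz0 normr0 mul0r subr0 lexx.
apply/orP; right; set m := `|y + z|; pose x := m^-1 *: (y + z).
have x1 : `|x| = 1 := norm_normalize yz0.
have [jx jxx] := duality_selection_unit hj x1.
have jyz : (j x y : R) + (j x z : R) = m.
  rewrite -dual_evalD -[y + z](@scalerKV _ _ m) ?normr_eq0//.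
  by rewrite dual_evalZ -/x jxx mulr1.
have jy1 : (j x y : R) <= 1 by have := dual_eval_le_norm y jx; rewrite y1.
have jz1 : (j x z : R) <= 1 by have := dual_eval_le_norm z jx; rewrite z1.
have tri : e <= `|x - y| + `|x - z|.
  rewrite -yz (_ : y - z = (x - z) - (x - y)).
    by rewrite [leRHS]addrC ler_normB.
  by rewrite opprB [RHS]addrC addrA subrK.
have [xy|xy] := leP (e / 2) `|x - y|.
  have := sphere x y x1 y1 xy; lra.
have : e / 2 <= `|x - z| by lra.
move=> /(sphere x z x1 z1); lra.
Qed.

End ConvexityOfNormPower.

(* C tbar p is the constant of item 1.  It is chosen before the space because
   item 3 uses it for the conjugate exponent and the dual space.
   The exponent in item 2 is read 1/(p-1): with the exponent (1/p)-1 the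
   estimate fails in the plane with the l^1 norm for p = 4, where
   rho_X(t) = t and phi(t) = 2t + K t^2 is admissible for some K. *)
Theorem theorem4p1 (R : realType) :
  exists C : R -> R -> R,
  (forall tbar p : R, 0 < tbar -> 1 < p -> 0 < C tbar p) /\
  forall (X : completeNormedModType R), dim_ge2 X ->
  forall (p : R), 1 < p ->
  forall (j : X -> dual X), duality_selection p j ->
  let F := norm_power p : X -> \bar R in
  let rhoF (x : X) (t : R) := functional_smoothness_modulus F (j x) x t in
  let deltaF (x : X) (t : R) := functional_convexity_modulus F (j x) x t in
  [/\ forall tbar : R, 0 < tbar ->
        forall (x : X) (t : R), `|x| = 1 -> 0 <= t <= tbar ->
        (rhoF x t <= (C tbar p * smoothness_modulus X t)%:E)%E,
      (forall tbar : R, 0 < tbar -> exists C' : R,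
        forall phi : R -> R,
        (forall (x : X) (t : R), `|x| = 1 -> 0 <= t <= tbar ->
          (rhoF x t <= (phi t)%:E)%E) ->
        forall t : R, 0 <= t <= tbar ->
        smoothness_modulus X t <= p `^ (1 / (p - 1)) * phi t + C' * t ^+ 2)
      /\ (forall (tbar : R) (phi : R -> R), 0 < tbar ->
        (forall t : R, 0 <= t -> 0 <= phi t) ->
        (forall (x : X) (t : R), `|x| = 1 -> 0 <= t <= tbar ->
          (rhoF x t <= (phi t)%:E)%E) ->
        phi t / t @[t --> (0 : R)^'+] --> (0 : R) ->
        uniformly_smooth X),
      forall p' : R, 1 / p + 1 / p' = 1 ->
        forall (x : X) (tbar : R), `|x| = 1 -> 0 < tbar ->
        0 < smoothness_modulus (dual X) tbar / tbar /\
        forall t : R,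
        0 <= t <= C tbar p' * (smoothness_modulus (dual X) tbar / tbar) ->
        ((C tbar p' * convexity_modulus X (t / C tbar p'))%:E <= deltaF x t)%E
    & forall (tbar : R) (phi : R -> R), 0 < tbar ->
        (forall t : R, 0 <= t -> 0 <= phi t) ->
        (forall s t : R, 0 <= s -> s <= t -> phi s <= phi t) ->
        (forall t : R, 0 < t -> 0 < phi t) ->
        (forall (x : X) (t : R), `|x| = 1 -> 0 <= t <= tbar ->
          ((phi t)%:E <= deltaF x t)%E) ->
        uniformly_convex X].
Proof.
exists (@smoothness_const R); split=> [T p T0 p1|X X2 p p1 j hj F rhoF deltaF].
  exact: smoothness_const_gt0 (ltW T0) p1.
have supp := duality_selection_support hj.
have breg x y (x1 : `|x| = 1) := bregman_norm_powerE y p1 x1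
  (proj1 (duality_selection_unit hj x1)) (proj2 (duality_selection_unit hj x1)).
have sup_ge (T : R) (phi : R -> R) (x y : X) :
    (forall (x : X) (t : R), `|x| = 1 -> 0 <= t <= T ->
      (rhoF x t <= (phi t)%:E)%E) -> `|x| = 1 -> `|x - y| <= T ->
    p^-1 * `|y| `^ p - p^-1 - (j x (y - x) : R) <= phi `|x - y|.
  move=> h x1 xyT; rewrite -lee_fin -breg//; apply: le_trans (h _ _ x1 _).
    by apply: ereal_sup_ubound; exists y.
  by rewrite normr_ge0.
have smooth (T : R) (phi : R -> R) (t : R) :
    (forall (x : X) (t : R), `|x| = 1 -> 0 <= t <= T ->
      (rhoF x t <= (phi t)%:E)%E) -> 0 <= t <= T ->
    smoothness_modulus X t <= phi t.
  move=> h /andP[t0 tT]; have [x0 x01] := dim_ge2_unit X2.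
  apply: (smoothness_modulus_le x01) => x y x1 y1.
  have p0 : 0 < p by lra.
  have side (s : R) : `|s| = t -> `|x + s *: y| - 1 - s * (j x y : R) <= phi t.
    move=> st; have := sup_ge T phi x (x + s *: y) h x1.
    rewrite opprD addrA subrr sub0r normrN normrZ y1 mulr1 st => /(_ tT).
    rewrite (_ : x + s *: y - x = s *: y); last by rewrite addrC addKr.
    rewrite dual_evalZ; apply: le_trans; rewrite lerD2r.
    have := powR_bernoulli (normr_ge0 (x + s *: y)) p1.
    rewrite -(ler_pM2l (_ : 0 < p^-1)) ?invr_gt0// mulrDr mulr1.
    by rewrite mulrA mulVf ?gt_eqF//; lra.
  have := side t (ger0_norm t0); have := side (- t).
  rewrite normrN ger0_norm// => /(_ erefl); rewrite scaleNr; lra.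
split.
- move=> T T0 x t x1 /andP[t0 tT]; apply: ge_ereal_sup => _ [y xy <-].
  have {}xy : `|x - y| = t := xy.
  have [jx jxx] := duality_selection_unit hj x1.
  rewrite /F breg// lee_fin.
  have yx : `|y - x| = t by rewrite distrC.
  have := @bregman_le_smoothness _ X x (y - x) (j x (y - x)) T p p1.
  rewrite yx => /(_ (smoothness_modulus_quadratic_space X2 supp t0) x1 tT).
  rewrite [x + (y - x)]addrC subrK; apply.
  by rewrite -[X in X - _]jxx -dual_evalB dual_eval_le_norm.
- split=> [T T0|T phi T0 phi0 h phit].
    (* No remainder arises: [smooth] gives [rho t <= phi t], and [p ^ (1 / (p - 1)) >= 1]. *)
    exists 0 => phi h t tT; rewrite mul0r addr0.
    apply: (le_trans (smooth T phi t h tT)).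
    have [x0 x01] := dim_ge2_unit X2.
    have phi0 : 0 <= phi t.
      apply: le_trans (smooth T phi t h tT); exact: smoothness_modulus_ge0 x01.
    apply: ler_peMl => //; rewrite -[leLHS](powRr0 p).
    by rewrite ler_powR ?divr_ge0 ?subr_ge0// ltW.
  have [x0 x01] := dim_ge2_unit X2.
  apply: (squeeze_cvgr (f := fun=> 0) (h := fun t => phi t / t)) => //.
    near=> t; have t0 : 0 < t by near: t; exact: nbhs_right_gt.
    rewrite divr_ge0 ?(ltW t0) ?(smoothness_modulus_ge0 _ x01)//=.
    rewrite ler_pM2r ?invr_gt0//; apply: (smooth T) => //.
    by rewrite (ltW t0)/=; near: t; exact: nbhs_right_le.
  exact: cvg_cst.
- move=> p' pp' x T x1 T0.
  have [jx jxx] := duality_selection_unit hj x1.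
  rewrite !div1r in pp'.
  have p'1 : 1 < p'.
    have p0 : 0 < p by lra.
    have pV0 : 0 < p^-1 by rewrite invr_gt0.
    have pV1 : p^-1 < 1 by rewrite invf_lt1.
    have [p'V p'V1] : 0 < p'^-1 /\ p'^-1 < 1 by lra.
    have p'0 : 0 < p' by rewrite -invr_gt0.
    by rewrite -invf_lt1.
  split.
    rewrite divr_gt0//.
    (* Positivity of the dual modulus follows from its quadratic lower bound. *)
    have := smoothness_modulus_quadratic_dual X2 supp (ltW T0).
    have : 0 < T ^+ 2 by rewrite exprn_gt0.
    move=> /lt_le_trans /[apply]; rewrite pmulr_rgt0//; lra.
  move=> t /andP[t0 tT]; apply: le_ereal_inf_tmp => _ [y xy <-].
  have {}xy : `|x - y| = t := xy.
  rewrite /F breg// lee_fin -xy; apply: bregman_ge_convexity => //.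
  by rewrite xy.
- move=> T phi T0 _ _ phi0 h.
  apply: (uniformly_convex_of_bregman X2 p1 hj T0 phi0) => x y x1 xyT.
  rewrite -lee_fin -breg//; apply: (le_trans (h _ _ x1 _)).
    by rewrite normr_ge0.
  by apply: ereal_inf_lbound; exists y.
Unshelve. all: by end_near.
Qed.
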